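(* Let $A$ be a nontrivial finite connected graph having a pendant vertex (a vertex of degree 1). Then the subdivision graph $S(A)$ is not 2-edge distance-balanced.
   Context: $S(A)$ is obtained from $A$ by inserting one new vertex into each edge of $A$, i.e. replacing each edge by a path of length 2. For a graph $X$, $d_X$ is shortest-path distance, and for a vertex $g$ and edge $f=xy$, $d_X(g,f)=\min\{d_X(g,x),d_X(g,y)\}$. $X$ is 2-edge distance-balanced if for all vertices $g,h$ with $d_X(g,h)=2$, $|\{f\in E(X): d_X(f,g)<d_X(f,h)\}|=|\{f\in E(X): d_X(f,h)<d_X(f,g)\}|$.
   Formalization: ''Nontrivial'' is taken to mean at least three vertices, which excludes the single edge K2: its subdivision is the path a–m–b, which is 2-edge distance-balanced, so the claim fails for K2 under the usual reading (at least two vertices). *)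

(* Defs.v *)
(* Mathematical Components *)
From mathcomp Require Import all_boot.

Set Implicit Arguments.
Unset Strict Implicit.
Unset Printing Implicit Defensive.

(* Finite simple graphs. *)
Record sgraph := SGraph {
  svertex :> finType;
  adj : rel svertex;
  adj_sym : symmetric adj;
  adj_irrefl : irreflexive adj }.

Arguments adj {s}.

Section Graph.
Variable G : sgraph.
Implicit Types (x y g h : G) (f : {set G}).

(* An edge is the unordered pair of its ends. *)
Definition edges : {set {set G}} :=
  [set f | [exists x : G, exists y : G, adj x y && (f == [set x; y])]].

Definition connected : Prop := forall x y, connect adj x y.

Definition degree x : nat := #|[set y | adj x y]|.

Definition pendant x : bool := degree x == 1.

(* Neither K1 nor K2, when G is connected and nonempty.  K2 has to be
   excluded: its subdivision is the path a - m - b, whose only pair of vertices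
   at distance 2 is {a, b}, and each of a and b is strictly closer to exactly
   one edge, so that this path is 2-edge distance-balanced. *)
Definition nontrivial : Prop := 2 < #|G|.

(* [path adj x p] is a walk with [size p] edges.  A shortest walk has fewer
   than #|G| edges, hence the bounded minimum; vertices in different
   components get the conventional value #|G|. *)
Definition dist x y : nat :=
  \big[minn/#|G|]_(n < #|G| | [exists p : n.-tuple G,
                                 path adj x p && (last x p == y)]) n.

(* For an edge f = xy this is min (dist g x) (dist g y), as distances never
   exceed #|G|. *)
Definition edist g f : nat := \big[minn/#|G|]_(x in f) dist g x.

Definition closer_edges g h : {set {set G}} :=
  [set f in edges | edist g f < edist h f].

Definition two_edge_distance_balanced : Prop :=
  forall g h, dist g h = 2 -> #|closer_edges g h| = #|closer_edges h g|.

Lemma leq_bigmin (I : finType) (P : pred I) (F : I -> nat) m k :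
  (k <= \big[minn/m]_(j | P j) F j) =
  (k <= m) && [forall (j | P j), k <= F j].
Proof.
rewrite -[X in _ && X]big_andE; elim: (index_enum I) => [|i r IHr].
  by rewrite !big_nil andbT.
by rewrite !big_cons; case: (P i); rewrite ?leq_min IHr //= andbCA.
Qed.

Lemma dist_le_card x y : dist x y <= #|G|.
Proof. by have := leqnn (dist x y); rewrite {2}/dist leq_bigmin => /andP[]. Qed.

Lemma dist_le_walk x p : path adj x p -> dist x (last x p) <= size p.
Proof.
move=> xp; have [ltpG|] := ltnP (size p) #|G|; last first.
  exact: leq_trans (dist_le_card _ _).
have := leqnn (dist x (last x p)).
rewrite {2}/dist leq_bigmin => /andP[_ /forall_inP/(_ (Ordinal ltpG))]; apply.
by apply/existsP; exists (in_tuple p); rewrite xp eqxx.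
Qed.

Lemma dist_walk x y : connect adj x y ->
  exists p, [/\ path adj x p, last x p = y & size p = dist x y].
Proof.
case/connectP=> p0 /shortenP[p xp up _] ->.
have ltpG : size p < #|G|.
  by rewrite -[(size p).+1]/(size (x :: p)) -(card_uniqP up) max_card.
pose P (n : 'I_#|G|) :=
  [exists q : n.-tuple G, path adj x q && (last x q == last x p)].
have Pp : P (Ordinal ltpG).
  by apply/existsP; exists (in_tuple p); rewrite xp eqxx.
have [/= n /existsP[q /andP[xq /eqP qy]] minn_n] := arg_minnP (@nat_of_ord _) Pp.
exists q; split=> //; apply/eqP; rewrite eqn_leq -{2}qy dist_le_walk // andbT.
by rewrite size_tuple leq_bigmin ltnW //=; apply/forall_inP.
Qed.

Lemma edist_pair g x y : edist g [set x; y] = minn (dist g x) (dist g y).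
Proof.
apply/eqP; rewrite eqn_leq; apply/andP; split.
  have := leqnn (edist g [set x; y]).
  rewrite {2}/edist leq_bigmin leq_min => /andP[_ /forall_inP le].
  by rewrite !le ?set21 ?set22.
rewrite leq_bigmin geq_min dist_le_card; apply/forall_inP => z.
by rewrite !inE geq_min => /orP[]/eqP->; rewrite leqnn ?orbT.
Qed.

End Graph.

Section Subdivision.
Variable A : sgraph.

(* The new vertices are the edges of A, and the new vertex inserted into f is
   adjacent exactly to the two ends of f. *)
Definition subdiv_vertex : finType := (A + {f : {set A} | f \in edges A})%type.

Definition subdiv_adj : rel subdiv_vertex := fun u v =>
  match u, v with
  | inl x, inr f | inr f, inl x => x \in val f
  | _, _ => false
  end.

Lemma subdiv_adj_sym : symmetric subdiv_adj.
Proof. by case=> x [] y. Qed.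

Lemma subdiv_adj_irrefl : irreflexive subdiv_adj.
Proof. by case. Qed.

Definition subdivision : sgraph := SGraph subdiv_adj_sym subdiv_adj_irrefl.

End Subdivision.

(* Main.v *)
Require Import Defs.
From mathcomp Require Import all_boot.

Set Implicit Arguments.
Unset Strict Implicit.
Unset Printing Implicit Defensive.

(** Let [a] be a pendant vertex of [A] with neighbour [b], and let [m] be the
    vertex inserted into [ab].  The vertices [a] and [b] are at distance 2 in
    [S(A)].  Since every walk leaving [a] passes through [m] and then [b], the
    only edge closer to [a] is [am].  On the other hand [b] has a second
    neighbour, so at least two edges contain [b], and these are closer to [b]. *)

Section Graph.
Variable G : sgraph.
Implicit Types (x y : G) (f : {set G}).

Lemma leq_dist k x y :
  (forall p, path adj x p -> last x p = y -> k <= size p) ->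
  k <= #|G| -> k <= dist x y.
Proof.
move=> le_k le_kG; rewrite leq_bigmin le_kG; apply/forall_inP => n.
by case/existsP=> p /andP[xp /eqP py]; rewrite -(size_tuple p) le_k.
Qed.

Lemma dist_eq0 x y : (dist x y == 0) = (x == y).
Proof.
apply/idP/eqP => [|<-]; last by rewrite -leqn0 (@dist_le_walk _ _ [::]).
apply: contraTeq => neq_xy; rewrite -lt0n; apply: leq_dist.
  by case=> //= _ /eqP; rewrite (negPf neq_xy).
by apply/card_gt0P; exists x.
Qed.

Lemma edist_eq0 x f : (edist x f == 0) = (x \in f).
Proof.
apply/idP/idP => [|xf].
  apply: contraTT => xNf; rewrite -lt0n leq_bigmin; apply/andP; split.
    by apply/card_gt0P; exists x.
  apply/forall_inP => y yf; rewrite lt0n dist_eq0.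
  by apply: contraNneq xNf => ->.
have := leqnn (edist x f); rewrite {2}/edist leq_bigmin => /andP[_].
by move/forall_inP/(_ x xf); rewrite (eqP (_ : dist x x == 0)) ?dist_eq0 // leqn0.
Qed.

Lemma edges_set2 x y : adj x y -> [set x; y] \in edges G.
Proof.
move=> xy; rewrite inE; apply/existsP; exists x; apply/existsP; exists y.
by rewrite xy eqxx.
Qed.

Lemma mem_closer_edges x y f :
  f \in edges G -> x \in f -> y \notin f -> f \in closer_edges x y.
Proof.
move=> fE xf yNf; rewrite inE fE /=.
by rewrite (eqP (_ : edist x f == 0)) ?edist_eq0 // lt0n edist_eq0.
Qed.

Section PendantPath.
Variables a m b : G.
Hypothesis adj_a : forall v, adj a v -> v = m.
Hypothesis adj_m : forall v, adj m v -> v = a \/ v = b.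
Hypothesis bm : adj b m.

Lemma dist_pendant_path u : u != a -> dist b u <= dist a u.
Proof.
move=> neq_ua; apply: leq_dist (dist_le_card _ _) => p.
have [n] := ubnP (size p); elim: n p => // n IHn [|x p] //= lt_pn.
  by move=> _ au; rewrite au eqxx in neq_ua.
case/andP=> /adj_a->; case: p lt_pn => [|y p] /= lt_pn.
  by move=> _ <-; apply: (@dist_le_walk _ b [:: m]); rewrite /= bm.
case/andP=> /adj_m[]-> xp pu.
  by rewrite (leq_trans (IHn p _ xp pu)) // ltnW // ltnW.
by rewrite -pu (leq_trans (dist_le_walk xp)) // ltnW.
Qed.

Lemma closer_edges_pendant : closer_edges a b \subset [set [set a; m]].
Proof.
apply/subsetP => f; rewrite !inE => /andP[].
case/existsP=> x /existsP[y /andP[xy /eqP->]].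
have [xa _|neq_xa] := eqVneq x a.
  by move: xy; rewrite xa => /adj_a->.
have [ya _|neq_ya] := eqVneq y a.
  by move: xy; rewrite adj_sym ya => /adj_a->; rewrite setUC.
rewrite !edist_pair ltnNge leq_min !geq_min.
by rewrite (dist_pendant_path neq_xa) (dist_pendant_path neq_ya) orbT.
Qed.

End PendantPath.

Lemma pendantP x : reflect (exists2 y, adj x y & forall z, adj x z -> z = y)
                           (pendant x).
Proof.
apply: (iffP cards1P) => [[y xE]|[y xy xE]]; exists y.
- by have := set11 y; rewrite -xE inE.
- by move=> z xz; apply/set1P; rewrite -xE inE.
- by apply/setP => z; rewrite !inE; apply/idP/eqP => [/xE|->].
Qed.

Lemma second_neighbour x y : connected G -> nontrivial G ->
  (forall z, adj x z -> z = y) -> exists2 z, adj y z & z != x.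
Proof.
move=> Gconn Gnt xE; apply/exists_inP; apply: contraLR Gnt => yE.
have clos_xy: closed adj [set x; y].
  apply: intro_closed => [|u v]; first by apply: sym_connect_sym; apply: adj_sym.
  rewrite !inE => uv /orP[]/eqP eq_u; move: uv; rewrite eq_u.
    by move/xE->; rewrite eqxx orbT.
  move=> yv; case: eqP => //= /eqP neq_vx.
  by case/exists_inP: yE; exists v.
rewrite -leqNgt -cardsT (leq_trans _ (_ : #|[set x; y]| <= 2)) //.
  apply/subset_leq_card/subsetP => z _.
  by rewrite -(closed_connect clos_xy (Gconn x z)) set21.
by rewrite cards2; case: (x != y).
Qed.

End Graph.

Section Subdivision.
Variable A : sgraph.

Definition midpoint (x y : A) (xy : adj x y) : subdivision A :=
  inr (exist _ [set x; y] (edges_set2 xy)).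

Lemma dist_subdivision (x y : A) : adj x y ->
  dist (inl x : subdivision A) (inl y : subdivision A) = 2.
Proof.
move=> xy; have neq_xy : x != y.
  by apply: contraTneq xy => ->; rewrite adj_irrefl.
apply/eqP; rewrite eqn_leq; apply/andP; split.
  apply: (@dist_le_walk _ _ [:: midpoint xy; inl y]).
  by rewrite /= /adj /= set21 set22.
apply: leq_dist => [[|u [|v p]] //=|].
- by move=> _ [/eqP]; rewrite (negPf neq_xy).
- by case: u => u //; rewrite /adj.
- have <- : #|[set (inl x : subdivision A); inl y]| = 2.
    by rewrite cards2 (inj_eq (@inl_inj _ _)) neq_xy.
  exact: max_card.
Qed.

End Subdivision.

Theorem theorem6 (A : sgraph) (A_conn : connected A) (A_nontriv : nontrivial A)
  (A_pendant : exists x : A, pendant x) :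
  ~ two_edge_distance_balanced (subdivision A).
Proof.
have [a /pendantP[b ab aE]] := A_pendant.
have [c bc neq_ca] := second_neighbour A_conn A_nontriv aE.
move=> /(_ _ _ (dist_subdivision ab)).
have neq_ab : a != b by apply: contraTneq ab => ->; rewrite adj_irrefl.
set m := midpoint ab; set m' := midpoint bc.
set a' : subdivision A := inl a; set b' : subdivision A := inl b.
have bm : adj b' m by rewrite /adj /= set22.
have bm' : adj b' m' by rewrite /adj /= set21.
have adj_a v : adj a' v -> v = m.
  case: v => [//|[f fE]]; rewrite /adj /= => af; congr inr; apply: val_inj => /=.
  move: fE af; rewrite inE.
  case/existsP=> x /existsP[y /andP[xy /eqP->]].
  case/set2P=> eq_a; move: xy; rewrite -eq_a; first by move/aE->.
  by rewrite adj_sym => /aE->; rewrite setUC.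
have adj_m v : adj m v -> v = a' \/ v = b'.
  case: v => // x; rewrite /adj /=.
  by case/set2P=> ->; [left | right].
have le1 := subset_leq_card (closer_edges_pendant adj_a adj_m bm).
have neq_m : m' != m.
  apply/eqP => -[/setP/(_ a)]; rewrite !inE eqxx (negPf neq_ab) /=.
  by rewrite eq_sym (negPf neq_ca).
have closer_b n : adj b' n -> n != a' -> [set b'; n] \in closer_edges b' a'.
  move=> bn neq_na; apply: mem_closer_edges; [exact: edges_set2 | exact: set21 |].
  by rewrite !inE negb_or (inj_eq (@inl_inj _ _)) neq_ab eq_sym neq_na.
have le2 : #|[set [set b'; m']; [set b'; m]]| <= #|closer_edges b' a'|.
  by apply/subset_leq_card/subsetP => f /set2P[]->; apply: closer_b.
move=> eq_card; move: le2; rewrite -eq_card => /leq_trans/(_ le1).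
rewrite cards1 cards2; case: eqP => // /setP/(_ m').
by rewrite !inE (negPf neq_m) eqxx.
Qed.
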